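(* Consider a Boolean control network (BCN) with $n$ state variables, $m$ inputs and $p$ outputs, with algebraic form $x(t+1)=Lu(t)x(t)$, $y(t)=Hx(t)$, where $L=[L_1,\dots,L_{2^m}]$, each $L_j\in\mathcal{L}_{2^n\times 2^n}$, and $H\in\mathcal{L}_{2^p\times 2^n}$. Assume that the BCN is decomposable with respect to outputs with order $n-s$. Let $\mathcal{G}_j$ be the directed graph with adjacency matrix $L_j$, let the vertices in $A=\{1,\dots,2^n\}$ be colored so that two vertices $\mu,\lambda$ have the same color if and only if $H\delta_{2^n}^\mu=H\delta_{2^n}^\lambda$, and let $\mathcal{S}=\{S_l\}_{l=1}^{2^s}$ (with $|S_l|=2^{n-s}$) be a common concolorous perfect equal vertex partition (CC-PEVP) of $\{\mathcal{G}_j\}_{j=1}^{2^m}$. Let $H_1,\dots,H_\tau$ be the distinct elements of the finite set $\mathcal{H}$ of all matrices $HL_{j_1}\cdots L_{j_r}$ ($r\ge0$, $1\le j_1,\dots,j_r\le 2^m$), and let $\mathcal{R}_1,\dots,\mathcal{R}_\tau$ be the corresponding partitions of $A$. Then $$\mathcal{S}\sqsubset\mathcal{C}:=\mathbf{gcr}(\mathcal{R}_1,\mathcal{R}_2,\dots,\mathcal{R}_\tau).$$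
   Context: Notation: $\delta_k^i$ is the $i$-th column of the identity matrix $I_k$, $\Delta_k=\{\delta_k^1,\dots,\delta_k^k\}$. A real $a\times b$ matrix is a logical matrix if every column lies in $\Delta_a$; $\mathcal{L}_{a\times b}$ is the set of all $a\times b$ logical matrices. $\mathrm{Col}_q(B)$ is the $q$-th column of $B$. BCN and algebraic form: let $\mathcal{D}=\{1,0\}$ (True, False). The BCN is $x_i(t+1)=f_i(x_1(t),\dots,x_n(t),u_1(t),\dots,u_m(t))$ $(1\le i\le n)$, $y_i(t)=h_i(x_1(t),\dots,x_n(t))$ $(1\le i\le p)$, with logical functions $f_i:\mathcal{D}^{n+m}\to\mathcal{D}$, $h_i:\mathcal{D}^n\to\mathcal{D}$. Identify True with $\delta_2^1$, False with $\delta_2^2$, and tuples with Kronecker products $x=x_1\otimes\cdots\otimes x_n\in\Delta_{2^n}$, $u=u_1\otimes\cdots\otimes u_m\in\Delta_{2^m}$, $y=y_1\otimes\cdots\otimes y_p\in\Delta_{2^p}$. Then $L,H$ are the unique logical matrices with $x(t+1)=L(u(t)\otimes x(t))$, written $Lu(t)x(t)$, and $y(t)=Hx(t)$; if $u(t)=\delta_{2^m}^j$ then $x(t+1)=L_jx(t)$. Decomposability: a logical coordinate transformation is a bijection $\mathcal{D}^n\to\mathcal{D}^n$, $(x_1,\dots,x_n)\mapsto(z_1,\dots,z_n)$. The BCN is decomposable with respect to outputs of (with) order $n-s$ ($0\le s\le n$) if there is a logical coordinate transformation under which it takes the form $z_i(t+1)=\hat f_i(z_1(t),\dots,z_s(t),u_1(t),\dots,u_m(t))$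 for $1\le i\le s$; $z_i(t+1)=\hat f_i(z_1(t),\dots,z_n(t),u_1(t),\dots,u_m(t))$ for $s+1\le i\le n$; $y_i(t)=\hat h_i(z_1(t),\dots,z_s(t))$ for $1\le i\le p$, with logical functions $\hat f_i,\hat h_i$. Graphs: $\mathcal{G}_j$ has vertex set $A=\{1,\dots,2^n\}$ and a directed edge $(q,k)$ if and only if $(L_j)_{kq}\neq 0$; then $k$ is an out-neighbor of $q$. $\mathcal{N}^j(S)$ denotes the set of all out-neighbors in $\mathcal{G}_j$ of vertices in $S\subset A$. Partitions: $\{S_l\}_{l=1}^{\mu}$ is a (vertex) partition of $A$ if $\bigcup_l S_l=A$ and $S_i\cap S_j=\emptyset$ for $i\ne j$ (empty members are allowed); it is an equal vertex partition if moreover $|S_l|=|A|/\mu$ for all $l$. Given a coloring of $A$, an equal vertex partition $\{S_l\}_{l=1}^\mu$ is a CC-PEVP of $\{\mathcal{G}_j\}_{j=1}^{2^m}$ if (i) for all $l$ and $j$ there exists $\alpha_l^j$ such that $\mathcal{N}^j(S_l)\subset S_{\alpha_l^j}$; and (ii) for each $l$, all vertices in $S_l$ have the same color. A partition $\mathcal{U}$ of $A$ is a refinement of a partition $\mathcal{V}$ of $A$, written $\mathcal{U}\sqsubset\mathcal{V}$, if for every $U\in\mathcal{U}$ there is $V\in\mathcal{V}$ with $U\subset V$. The greatest common refinement $\mathbf{gcr}(\mathcal{V}_1,\mathcal{V}_2)$ is the partition consisting of all nonempty intersections $V_1\cap V_2$ with $V_i\in\mathcal{V}_i$, and inductively $\mathbf{gcr}(\mathcal{V}_1,\dots,\mathcal{V}_\mu)=\mathbf{gcr}(\mathbf{gcr}(\mathcal{V}_1,\dots,\mathcal{V}_{\mu-1}),\mathcal{V}_\mu)$;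 i.e. it consists of all nonempty intersections $V_1\cap\cdots\cap V_\mu$, $V_i\in\mathcal{V}_i$. The partitions $\mathcal{R}_i$: the set $\mathcal{H}$ includes $H$ itself ($r=0$) and is finite since there are finitely many $2^p\times 2^n$ logical matrices. For $H_i\in\mathcal{H}$, $\mathcal{R}_i=\{R_{i,k}\}_{k=1}^{2^p}$ with $R_{i,k}=\{q\in A:\mathrm{Col}_q(H_i)=\delta_{2^p}^k\}$. *)

(* Defs.v *)
From HB Require Import structures.
From mathcomp Require Import all_boot all_order all_algebra.
From mathcomp Require Import mxtens.
From mathcomp Require Import reals.

Set Implicit Arguments.
Unset Strict Implicit.
Unset Printing Implicit Defensive.

Import GRing.Theory.
Local Open Scope ring_scope.

(* All indices start at 0: the vector written delta_k^(i+1) in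
   1-based notation is delta_mx i 0 : 'cV_k with i : 'I_k, and the vertex set
   {1, ..., 2^n} is 'I_(2 ^ n). *)

Section LogicalMatrices.
Variable R : realType.

Definition is_logical a b (M : 'M[R]_(a, b)) : Prop :=
  forall q : 'I_b, exists k : 'I_a, col q M = delta_mx k 0.

Definition bool_vec (b : bool) : 'cV[R]_2 := delta_mx (if b then 0 else 1) 0.

(* x_1 *t (x_2 *t ( ... )); the casts only identify 2 * 2 ^ n' with 2 ^ n'.+1. *)
Fixpoint kron_vec n : n.-tuple bool -> 'cV[R]_(2 ^ n) :=
  match n with
  | 0 => fun _ => 1%:M
  | n'.+1 => fun x =>
      castmx (esym (expnS 2 n'), erefl 1%N)
        (tensmx (bool_vec (thead x)) (kron_vec [tuple of behead x]))
  end.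

End LogicalMatrices.

Record bcn (n m p : nat) := BCN {
  bcn_f : 'I_n -> n.-tuple bool -> m.-tuple bool -> bool;
  bcn_h : 'I_p -> n.-tuple bool -> bool
}.

Section Networks.
Variables n m p : nat.

Definition bcn_next (B : bcn n m p) (x : n.-tuple bool) (u : m.-tuple bool) :
  n.-tuple bool := [tuple bcn_f B i x u | i < n].

Definition bcn_out (B : bcn n m p) (x : n.-tuple bool) : p.-tuple bool :=
  [tuple bcn_h B i x | i < p].

Definition algebraic_form (R : realType) (B : bcn n m p)
    (L : 'M[R]_(2 ^ n, 2 ^ m * 2 ^ n)) (H : 'M[R]_(2 ^ p, 2 ^ n)) : Prop :=
  [/\ is_logical L, is_logical H,
      forall x u, kron_vec R (bcn_next B x u) =
        L *m (tensmx (kron_vec R u) (kron_vec R x) : 'cV_(2 ^ m * 2 ^ n))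
    & forall x, kron_vec R (bcn_out B x) = H *m kron_vec R x].

(* mxtens_index (j, q) = j * 2 ^ n + q, so L = [L_1, ..., L_(2^m)]. *)
Definition Lblock (R : realType) (L : 'M[R]_(2 ^ n, 2 ^ m * 2 ^ n))
    (j : 'I_(2 ^ m)) : 'M[R]_(2 ^ n) :=
  \matrix_(k, q) L k (mxtens_index (j, q)).

Definition first_coords s (hs : (s <= n)%N) (z : n.-tuple bool) :
  s.-tuple bool := [tuple tnth z (widen_ord hs i) | i < s].

(* Decomposability with order n - s, through z = T x. *)
Definition decomposable s (hs : (s <= n)%N) (B : bcn n m p) : Prop :=
  exists T : n.-tuple bool -> n.-tuple bool, bijective T /\
  exists (f1 : 'I_n -> s.-tuple bool -> m.-tuple bool -> bool)
         (f2 : 'I_n -> n.-tuple bool -> m.-tuple bool -> bool)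
         (h' : 'I_p -> s.-tuple bool -> bool),
  [/\ forall (i : 'I_n) x u, (i < s)%N ->
        tnth (T (bcn_next B x u)) i = f1 i (first_coords hs (T x)) u,
      forall (i : 'I_n) x u, (s <= i)%N ->
        tnth (T (bcn_next B x u)) i = f2 i (T x) u
    & forall (i : 'I_p) x,
        tnth (bcn_out B x) i = h' i (first_coords hs (T x))].

End Networks.

(* Edge (q, k) iff the entry in row k and column q is nonzero. *)
Definition adj_graph (R : realType) N (M : 'M[R]_N) : rel 'I_N :=
  fun q k => M k q != 0.

Section Partitions.
Variable A : finType.

Definition out_nbrs (G : rel A) (S : {set A}) : {set A} :=
  [set k | [exists q in S, G q k]].

(* Unlike finset's [partition], empty members are allowed. *)
Definition is_partition mu (S : 'I_mu -> {set A}) : Prop :=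
  \bigcup_l S l = [set: A] /\ (forall i j, i != j -> S i :&: S j = set0).

Definition equal_partition mu (S : 'I_mu -> {set A}) : Prop :=
  is_partition S /\ (forall l, (#|S l| * mu)%N = #|A|).

Definition cc_pevp (C J : Type) (color : A -> C) (G : J -> rel A)
    mu (S : 'I_mu -> {set A}) : Prop :=
  [/\ equal_partition S,
      forall l j, exists alpha : 'I_mu, out_nbrs (G j) (S l) \subset S alpha
    & forall l q q', q \in S l -> q' \in S l -> color q = color q'].

Definition members mu (S : 'I_mu -> {set A}) : {set {set A}} :=
  [set S l | l : 'I_mu].

Definition refinement (U V : {set {set A}}) : Prop :=
  forall X, X \in U -> exists2 Y, Y \in V & X \subset Y.

Definition gcr2 (V1 V2 : {set {set A}}) : {set {set A}} :=
  [set X :&: Y | X in V1, Y in V2] :\ set0.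

(* Starting from the one-block partition makes gcr [:: V] the set of nonempty
   members of V, as required by the "all nonempty intersections" description;
   for two or more partitions it changes nothing. *)
Definition gcr (Vs : seq {set {set A}}) : {set {set A}} :=
  foldl gcr2 [set [set: A]] Vs.

End Partitions.

Section OutputMatrices.
Variables (R : realType) (n m p : nat).

(* H *m L_(j_1) *m ... *m L_(j_r) for js = [:: j_1; ...; j_r]. *)
Definition out_word (L : 'M[R]_(2 ^ n, 2 ^ m * 2 ^ n)) (H : 'M[R]_(2 ^ p, 2 ^ n))
    (js : seq 'I_(2 ^ m)) : 'M[R]_(2 ^ p, 2 ^ n) :=
  foldl (fun M j => M *m Lblock L j) H js.

Definition calH (L : 'M[R]_(2 ^ n, 2 ^ m * 2 ^ n)) (H : 'M[R]_(2 ^ p, 2 ^ n))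
    (M : 'M[R]_(2 ^ p, 2 ^ n)) : Prop :=
  exists js, M = out_word L H js.

Definition Rpart (M : 'M[R]_(2 ^ p, 2 ^ n)) (k : 'I_(2 ^ p)) : {set 'I_(2 ^ n)} :=
  [set q | col q M == delta_mx k 0].

End OutputMatrices.

(* Main.v *)
(* If every block of S is mapped by each L_j into a block of S, then "the columns
   of M agree on each block of S" passes from M to M L_j: column q of M L_j is
   the column of M at the out-neighbour of q. It holds for H by the colouring,
   hence for every word H L_(j_1) ... L_(j_r). *)

Require Import Defs.
From mathcomp Require Import all_boot all_order all_algebra.
From mathcomp Require Import mxtens.
From mathcomp Require Import reals.

Set Implicit Arguments.
Unset Strict Implicit.
Unset Printing Implicit Defensive.

Import GRing.Theory.
Local Open Scope ring_scope.

(** Intersecting members that contain [X] gives a set that still contains [X]; since [X] is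
    nonempty, so is this set, and it survives the removal of [set0] in [gcr2]. *)
Lemma gcr_refined (A : finType) (X : {set A}) (Vs : seq {set {set A}}) :
  X != set0 ->
  (forall V, V \in Vs -> exists2 Y, Y \in V & X \subset Y) ->
  exists2 Y, Y \in gcr Vs & X \subset Y.
Proof.
move=> X0; rewrite /gcr.
have : exists2 Y, Y \in [set [set: A]] & X \subset Y.
  by exists [set: A]; rewrite ?set11 ?subsetT.
(* The starting partition is generalized to any [U] with a member containing [X], because [foldl]
   changes its accumulator. *)
elim: Vs [set [set: A]] => [|V Vs IH] U //= [Z ZU XZ] HVs.
have [Y YV XY] := HVs _ (mem_head V Vs).
apply: IH => [|W WVs]; last by apply: HVs; rewrite inE WVs orbT.
have XZY : X \subset Z :&: Y by rewrite subsetI XZ.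
exists (Z :&: Y) => //.
rewrite /gcr2 !inE imset2_f // andbT -subset0.
by apply: contra X0 => ZY0; rewrite -subset0 (subset_trans XZY).
Qed.

Section LogicalMatrixProducts.
Variable R : realType.

Lemma col_mul_delta a b c (M : 'M[R]_(a, b)) (N : 'M[R]_(b, c)) q k :
  col q N = delta_mx k 0 -> col q (M *m N) = col k M.
Proof. by move=> Nq; rewrite !colE -mulmxA -colE Nq. Qed.

Lemma is_logical_mul a b c (M : 'M[R]_(a, b)) (N : 'M[R]_(b, c)) :
  is_logical M -> is_logical N -> is_logical (M *m N).
Proof.
move=> lM lN q; have [k Nq] := lN q; have [i Mk] := lM k.
by exists i; rewrite (col_mul_delta _ Nq).
Qed.

Lemma is_logical_Lblock n m (L : 'M[R]_(2 ^ n, 2 ^ m * 2 ^ n)) j :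
  is_logical L -> is_logical (Lblock L j).
Proof.
move=> lL q; have [k Lk] := lL (mxtens_index (j, q)).
by exists k; rewrite -Lk; apply/colP => i; rewrite !mxE.
Qed.

Lemma adj_graph_col_delta N (M : 'M[R]_N) q k :
  col q M = delta_mx k 0 -> adj_graph M q k.
Proof.
by move=> /colP/(_ k); rewrite /adj_graph !mxE !eqxx => ->; exact: oner_neq0.
Qed.

(** Ensures that each column of a word is some [delta_mx k 0], so that every vertex lies in a class
    of [Rpart]. *)
Lemma is_logical_out_word n m p (L : 'M[R]_(2 ^ n, 2 ^ m * 2 ^ n))
    (H : 'M[R]_(2 ^ p, 2 ^ n)) js :
  is_logical L -> is_logical H -> is_logical (out_word L H js).
Proof.
move=> lL; elim: js H => [|j js IH] H lH //=.
by apply/IH/is_logical_mul => //; exact: is_logical_Lblock.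
Qed.

Lemma out_word_col_const n m p mu (L : 'M[R]_(2 ^ n, 2 ^ m * 2 ^ n))
    (S : 'I_mu -> {set 'I_(2 ^ n)}) (H : 'M[R]_(2 ^ p, 2 ^ n)) js :
  is_logical L ->
  (forall l j, exists alpha,
     out_nbrs (adj_graph (Lblock L j)) (S l) \subset S alpha) ->
  (forall l, {in S l &, forall q q', col q H = col q' H}) ->
  forall l, {in S l &, forall q q',
    col q (out_word L H js) = col q' (out_word L H js)}.
Proof.
(* [H] stays general: the word for [j :: js] starting from [H] is the word for [js] starting from
   [H *m Lblock L j]. *)
move=> lL nbrS; elim: js H => [|j js IH] H constH //=.
apply: IH => l q q' qS q'S.
have [k Lq] := is_logical_Lblock j lL q.
have [k' Lq'] := is_logical_Lblock j lL q'.
(* It remains to compare columns [k] and [k'] of [H]; these out-neighbours of [q] and [q'] share the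
   block [S alpha]. *)
rewrite (col_mul_delta _ Lq) (col_mul_delta _ Lq').
have [alpha /subsetP sub] := nbrS l j.
by apply: (constH alpha); apply: sub; rewrite inE; apply/existsP;
  [exists q; rewrite qS | exists q'; rewrite q'S]; exact: adj_graph_col_delta.
Qed.

End LogicalMatrixProducts.

Theorem corollary1 (R : realType) (n m p s : nat) (hs : (s <= n)%N)
  (B : bcn n m p)
  (L : 'M[R]_(2 ^ n, 2 ^ m * 2 ^ n)) (H : 'M[R]_(2 ^ p, 2 ^ n))
  (hLH : algebraic_form B L H)
  (hdec : decomposable hs B)
  (C : Type) (color : 'I_(2 ^ n) -> C)
  (hcolor : forall mu lambda : 'I_(2 ^ n),
     color mu = color lambda <->
     H *m (delta_mx mu 0 : 'cV[R]_(2 ^ n)) =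
     H *m (delta_mx lambda 0 : 'cV[R]_(2 ^ n)))
  (S : 'I_(2 ^ s) -> {set 'I_(2 ^ n)})
  (hS : cc_pevp color (fun j : 'I_(2 ^ m) => adj_graph (Lblock L j)) S)
  (hScard : forall l, #|S l| = (2 ^ (n - s))%N)
  (tau : nat) (Hs : 'I_tau -> 'M[R]_(2 ^ p, 2 ^ n))
  (hHinj : injective Hs)
  (hHs : forall M : 'M[R]_(2 ^ p, 2 ^ n), (exists i, Hs i = M) <-> calH L H M) :
  refinement (members S) (gcr [seq members (Rpart (Hs i)) | i <- enum 'I_tau]).
Proof.
have [lL lH _ _] := hLH; have [_ nbrS colS] := hS.
have constH l : {in S l &, forall q q', col q H = col q' H}.
  by move=> q q' qS q'S; rewrite !colE; apply/hcolor/(colS l).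
move=> _ /imsetP [l _ ->].
(* The representative [q] shows that the block is nonempty, and its column in [Hs i] selects the
   class of [Rpart (Hs i)] containing all of [S l]. *)
have /card_gt0P [q qS] : (0 < #|S l|)%N by rewrite hScard expn_gt0.
apply: gcr_refined => [|_ /mapP [i _ ->]]; first by apply/set0Pn; exists q.
have [js Hi] : calH L H (Hs i) by apply/hHs; exists i.
have [k Hk] := is_logical_out_word js lL lH q.
exists (Rpart (Hs i) k); first by apply/imsetP; exists k.
apply/subsetP => q' q'S; rewrite inE Hi -Hk; apply/eqP.
exact: (out_word_col_const js lL nbrS constH q'S qS).
Qed.
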